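(* Let $\Omega\subset\mathbb R^n$ be a bounded open set, $1<p<\infty$, and let $\theta:\overline\Omega\to\mathbb R$ be Lipschitz on $\overline\Omega$. Let $t_0\in\mathbb R$. Assume that there exist $\delta_0>0$, constants $c_1,c_2>0$, and parameters $\alpha\in[0,1)$, $\nu\ge0$ such that \[ c_1(t-t_0)^{\alpha(p-1)+\nu}\le A_{p,\theta}(t)\le c_2(t-t_0)^{\alpha(p-1)+\nu} \] for almost every $t\in(t_0,t_0+\delta_0)$. Then, for every $\delta\in(0,\delta_0)$, one has \[ \int_{t_0}^{t_0+\delta}A_{p,\theta}(t)^{-1/(p-1)}\,\mathrm{d}t<\infty\quad\Longleftrightarrow\quad\alpha+\frac{\nu}{p-1}<1. \] In particular, if $\alpha+\frac{\nu}{p-1}\ge1$, then $\operatorname{cap}_{p,\theta}(t_0,t_0+\delta)=0$ for every $\delta\in(0,\delta_0)$.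
   Context: For $t\in\mathbb R$ let $\Sigma_t=\{x\in\Omega:\theta(x)=t\}$. The energy weight is defined for almost every $t$ by \[A_{p,\theta}(t)=\int_{\Sigma_t\cap\Omega}|\nabla\theta|^{p-1}\,\mathrm{d}\mathcal H^{n-1},\] with $\nabla\theta$ the almost everywhere defined gradient (by the coarea formula it is defined $\mathcal H^{n-1}$-a.e. on $\Sigma_t$ for a.e. $t$). For $a<b$ and $v\in W^{1,1}(a,b)$ (absolutely continuous representative on $[a,b]$) set $\mathcal E_{p,\theta}(v;a,b)=\int_a^b|v'(t)|^pA_{p,\theta}(t)\,\mathrm{d}t\in[0,+\infty]$, and \[\operatorname{cap}_{p,\theta}(a,b)=\inf\{\mathcal E_{p,\theta}(v;a,b): v\in W^{1,1}(a,b),\ v(a)=0,\ v(b)=1,\ \mathcal E_{p,\theta}(v;a,b)<\infty\}.\] *)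

(* Defs.v *)
From HB Require Import structures.
From mathcomp Require Import all_boot all_order all_algebra.
From mathcomp Require Import all_classical all_reals all_analysis.

Set Implicit Arguments.
Unset Strict Implicit.
Unset Printing Implicit Defensive.

Import Order.TTheory GRing.Theory Num.Theory.
Import numFieldNormedType.Exports.

Local Open Scope classical_set_scope.
Local Open Scope ring_scope.

(* The library norm on 'rV[R]_n is the sup norm, which induces the same topology
   and the same bounded sets and Lipschitz functions as [enorm]; the Euclidean
   norm matters only for gradients and diameters. *)
Definition enorm (R : realType) (n : nat) (x : 'rV[R]_n) : R :=
  Num.sqrt (\sum_(i < n) x ord0 i ^+ 2).

(* The value 0 off the differentiability set is a convention for points where
   the gradient is undefined (a Lebesgue-null set, by Rademacher). *)
Definition grad (R : realType) (n : nat) (f : 'rV[R]_n -> R) (x : 'rV[R]_n) :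
    'rV[R]_n :=
  if `[< differentiable f x >] then
    \row_(i < n) 'D_(delta_mx ord0 i) f x
  else 0.

(* Lebesgue measure of the Euclidean unit ball of R^m, that is
   pi^(m/2) / Gamma(m/2 + 1), through the recursion w_(m+2) = (2 pi/(m+2)) w_m. *)
Fixpoint unit_ball_volume (R : realType) (m : nat) : R :=
  match m with
  | 0 => 1
  | 1 => 2
  | m'.+2 => 2 * pi / m'.+2%:R * unit_ball_volume R m'
  end.

Section hausdorff.
Local Open Scope ereal_scope.
Context (R : realType) (n : nat).
Implicit Types (A C : set 'rV[R]_n) (m : nat) (d : R).

(* diam set0 = -oo. *)
Definition diam C : \bar R :=
  ereal_sup [set (enorm (x - y))%:E | x in C & y in C].

(* The empty set is singled out so that it costs 0 also when m = 0, where every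
   nonempty set costs 1. *)
Definition hausdorff_gauge m C : \bar R :=
  if `[< C = set0 >] then 0
  else (unit_ball_volume R m)%:E * (diam C * (2^-1)%:E) ^+ m.

Definition diam_cover d A : set ((set 'rV[R]_n)^nat) :=
  [set F | A `<=` \bigcup_k F k /\ forall k, diam (F k) <= d%:E].

Definition hausdorff_pre m d A : \bar R :=
  ereal_inf [set \sum_(k <oo) hausdorff_gauge m (F k) | F in diam_cover d A].

(* m-dimensional Hausdorff (outer) measure. *)
Definition hausdorff m A : \bar R :=
  ereal_sup [set hausdorff_pre m d A | d in [set d : R | (0 < d)%R]].

Lemma unit_ball_volume_ge0 m : (0 <= unit_ball_volume R m)%R.
Proof.
suff : (0 <= unit_ball_volume R m)%R /\ (0 <= unit_ball_volume R m.+1)%R by case.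
elim: m => [|m [h0 h1]]; first by split => /=; rewrite ?ler01// ler0n.
split => //; apply: mulr_ge0 => //; apply: divr_ge0; last exact: ler0n.
by apply: mulr_ge0; [exact: ler0n|exact: pi_ge0].
Qed.

Lemma diam_ge0 C : C !=set0 -> 0 <= diam C.
Proof.
move=> [x Cx]; apply: (@le_trans _ _ (enorm (x - x))%:E).
  by rewrite lee_fin; exact: sqrtr_ge0.
by apply: ereal_sup_ubound; exists x => //; exists x.
Qed.

Lemma hausdorff_gauge_ge0 m C : 0 <= hausdorff_gauge m C.
Proof.
rewrite /hausdorff_gauge; case: asboolP => // /eqP/set0P C0.
apply: mule_ge0; first by rewrite lee_fin unit_ball_volume_ge0.
apply: expe_ge0; apply: mule_ge0; first exact: diam_ge0.
by rewrite lee_fin invr_ge0 ler0n.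
Qed.

Lemma hausdorff_gauge0 m : hausdorff_gauge m set0 = 0.
Proof. by rewrite /hausdorff_gauge; case: asboolP. Qed.

Lemma hausdorff_pre_ge0 m d A : 0 <= hausdorff_pre m d A.
Proof.
apply: le_ereal_inf_tmp => _ [F _ <-].
by apply: nneseries_ge0 => k *; exact: hausdorff_gauge_ge0.
Qed.

Lemma hausdorff_pre0 m d : hausdorff_pre m d set0 = 0.
Proof.
apply/eqP; rewrite eq_le hausdorff_pre_ge0 andbT.
apply: ereal_inf_lbound; exists (fun=> set0).
  split => // k; rewrite /diam [X in ereal_sup X](_ : _ = set0) ?ereal_sup0 ?leNye//.
  by rewrite -subset0 => z [x []].
by apply: eseries0 => k _ _; exact: hausdorff_gauge0.
Qed.

Lemma le_hausdorff_pre m d : {homo hausdorff_pre m d : A B / A `<=` B >-> A <= B}.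
Proof.
move=> A B AB; apply/ereal_inf_le_tmp => _ [F [BF dF] <-].
by exists F => //; split => //; exact: subset_trans BF.
Qed.

Lemma hausdorff_pre_sigma_subadditive m d : sigma_subadditive (hausdorff_pre m d).
Proof.
move=> A; have [[i ioo]|] := pselect (exists i, hausdorff_pre m d (A i) = +oo).
  rewrite (eseries_pinfty _ _ ioo) ?leey// => k _.
  by rewrite -ltNye (lt_le_trans _ (hausdorff_pre_ge0 _ _ _)).
rewrite -forallNE => Aoo.
suff add2e (e : {posnum R}) : hausdorff_pre m d (\bigcup_k A k) <=
    \sum_(i <oo) hausdorff_pre m d (A i) + e%:num%:E.
  by apply/lee_addgt0Pr => _/posnumP[].
rewrite (le_trans _ (epsilon_trick _ _ _))//; last first.
  by move=> k; exact: hausdorff_pre_ge0.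
pose P k B := diam_cover d (A k) B /\ \sum_(i <oo) hausdorff_gauge m (B i) <=
  hausdorff_pre m d (A k) + (e%:num / (2 ^ k.+1)%:R)%:E.
have [G PG] : {G : ((set 'rV[R]_n)^nat)^nat & forall k, P k (G k)}.
  apply: (@choice _ _ P) => k; rewrite /P /hausdorff_pre.
  set S := (X in ereal_inf X); move infS : (ereal_inf S) => iS.
  case: iS infS => [r Sr|Soo|Soo].
  - have en1 : (0 < e%:num / (2 ^ k.+1)%:R)%R by [].
    have /(lb_ereal_inf_adherent en1) : ereal_inf S \is a fin_num by rewrite Sr.
    move=> [x [B AnB muBx] xS].
    by exists B; split => //; rewrite muBx -Sr; exact/ltW.
  - by have := Aoo k; rewrite /hausdorff_pre Soo.
  - by have := hausdorff_pre_ge0 m d (A k); rewrite /hausdorff_pre -/S Soo.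
pose g := hausdorff_gauge m.
have g0 C : 0 <= g C by exact: hausdorff_gauge_ge0.
apply: (@le_trans _ _ (\esum_(i in setT) (g \o uncurry G) i)).
  apply: ereal_inf_lbound => /=.
  have /card_esym/ppcard_eqP[f] := card_nat2.
  exists (uncurry G \o f).
    split => [t [i _ Ait]|k]; last first.
      by rewrite /=; case: (f k) => i j /=; exact: (PG i).1.2.
    have [j _ Gijt] := (PG i).1.1 _ Ait.
    by exists (f^-1%FUN (i, j)) => //=; rewrite invK ?inE.
  rewrite -(esum_pred_image (g \o uncurry G) _ xpredT) ?[fun=> _]set_true//.
  - by rewrite image_eq.
  - by move=> k _; exact: g0.
rewrite (_ : esum _ _ = \sum_(i <oo) \sum_(j <oo) g (G i j)); last first.
  pose J : nat -> set (nat * nat) := fun i => [set (i, j) | j in setT].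
  rewrite (_ : setT = \bigcup_k J k); last first.
    by rewrite predeqE => -[a b]; split => // _; exists a => //; exists b.
  rewrite esum_bigcupT /=; last 2 first.
    - apply/trivIsetP => i j _ _ ij.
      rewrite predeqE => -[k l] /=; split => //= -[] [_] _ [<-{k} _].
      by move=> [m' _] [] /esym/eqP; rewrite (negbTE ij).
    - by move=> /= [k l]; exact: g0.
  rewrite -(image_id [set: nat]) -fun_true esum_pred_image//; last first.
    by move=> k _; exact: esum_ge0.
  apply: eq_eseriesr => /= j _.
  rewrite -(esum_pred_image (g \o uncurry G) (pair j) predT)//=; last first.
    by move=> ? ? _ _; exact: (@can_inj _ _ _ snd).
  by congr esum; rewrite predeqE => -[a b]; split; move=> [i _ <-]; exists i.
apply: lee_lim.
- by apply: is_cvg_nneseries => k *; apply: nneseries_ge0 => l *; exact: g0.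
- by apply: is_cvg_nneseries => k *; apply: adde_ge0 => //; exact: hausdorff_pre_ge0.
- by near=> k; apply: lee_sum => i _; exact: (PG i).2.
Unshelve. all: by end_near. Qed.

Lemma hausdorff_pre_le m d A : (0 < d)%R -> hausdorff_pre m d A <= hausdorff m A.
Proof. by move=> d0; apply: ereal_sup_ubound; exists d. Qed.

Lemma hausdorff_ge0 m A : 0 <= hausdorff m A.
Proof.
exact: le_trans (hausdorff_pre_ge0 m 1 A) (hausdorff_pre_le m A ltr01).
Qed.

Lemma hausdorff0 m : hausdorff m set0 = 0.
Proof.
apply/eqP; rewrite eq_le hausdorff_ge0 andbT.
by apply: ge_ereal_sup => _ [d _ <-]; rewrite hausdorff_pre0.
Qed.

Lemma le_hausdorff m : {homo hausdorff m : A B / A `<=` B >-> A <= B}.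
Proof.
move=> A B AB; apply: ge_ereal_sup => _ [d d0 <-].
exact: le_trans (le_hausdorff_pre m d AB) (hausdorff_pre_le m B d0).
Qed.

Lemma hausdorff_sigma_subadditive m : sigma_subadditive (hausdorff m).
Proof.
move=> F; apply: ge_ereal_sup => _ [d d0 <-].
apply: le_trans (hausdorff_pre_sigma_subadditive m d F) _.
apply: lee_nneseries => k _ *; first exact: hausdorff_pre_ge0.
exact: hausdorff_pre_le.
Qed.

HB.instance Definition _ m := isOuterMeasure.Build R 'rV[R]_n (hausdorff m)
  (hausdorff0 m) (hausdorff_ge0 m) (@le_hausdorff m)
  (@hausdorff_sigma_subadditive m).

End hausdorff.

(* The outer measure above, as a measure on its Caratheodory sigma-algebra (which
   contains the Borel sets). *)
Definition hausdorff_measure (R : realType) (n m : nat) :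
    set (caratheodory_type (@hausdorff R n m)) -> \bar R :=
  @hausdorff R n m.

HB.instance Definition _ (R : realType) (n m : nat) :=
  isMeasure.Build _ _ _ (@hausdorff_measure R n m)
    (@caratheodory_measure0 _ _ (@hausdorff R n m))
    (@caratheodory_measure_ge0 _ _ (@hausdorff R n m))
    (@caratheodory_measure_sigma_additive _ _ (@hausdorff R n m)).

Definition level_set (R : realType) (n : nat) (Omega : set 'rV[R]_n)
    (theta : 'rV[R]_n -> R) (t : R) : set 'rV[R]_n :=
  [set x | Omega x /\ theta x = t].

Definition energy_weight (R : realType) (n : nat) (Omega : set 'rV[R]_n)
    (p : R) (theta : 'rV[R]_n -> R) (t : R) : \bar R :=
  (\int[@hausdorff_measure R n n.-1]_(x in level_set Omega theta t)
     (enorm (grad theta x) `^ (p - 1))%:E)%E.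

Section one_dimensional.
Context (R : realType).
Local Notation mu := (@lebesgue_measure R).
Implicit Types (a b : R) (v w phi : R -> R).

Definition test_function a b phi : Prop :=
  [/\ forall (k : nat) (x : R), derivable (phi^`(k)%classic) x 1,
      compact (closure [set x | phi x != 0])
    & closure [set x | phi x != 0] `<=` `]a, b[ ].

Definition weak_derivative a b v w : Prop :=
  forall phi, test_function a b phi ->
    \int[mu]_(x in `]a, b[) (v x * phi^`()%classic x) =
    - \int[mu]_(x in `]a, b[) (w x * phi x).

Definition sobolev11 a b v : Prop :=
  mu.-integrable `]a, b[ (EFin \o v) /\
  exists2 w, mu.-integrable `]a, b[ (EFin \o w) & weak_derivative a b v w.

Definition abs_continuous a b v : Prop :=
  forall e : R, 0 < e -> exists2 d : R, 0 < d &
    forall (m : nat) (x y : 'I_m -> R),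
      (forall i, a <= x i /\ x i <= y i /\ y i <= b) ->
      trivIset setT (fun i => `]x i, y i[%classic) ->
      \sum_(i < m) (y i - x i) < d ->
      \sum_(i < m) `|v (y i) - v (x i)| < e.

(* [v^`()] is the pointwise derivative; for the absolutely continuous
   representative it exists a.e. and is the weak derivative. *)
Definition energy (n : nat) (Omega : set 'rV[R]_n) (p : R)
    (theta : 'rV[R]_n -> R) v a b : \bar R :=
  (\int[mu]_(t in `]a, b[)
     ((`|v^`()%classic t| `^ p)%:E * energy_weight Omega p theta t))%E.

Definition capacity (n : nat) (Omega : set 'rV[R]_n) (p : R)
    (theta : 'rV[R]_n -> R) a b : \bar R :=
  ereal_inf [set energy Omega p theta v a b | v in
    [set v | [/\ sobolev11 a b v, abs_continuous a b v, v a = 0, v b = 1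
               & (energy Omega p theta v a b < +oo)%E]]].

End one_dimensional.

(* Main.v *)
(* With beta = alpha (p - 1) + nu and r = beta / (p - 1) = alpha + nu / (p - 1), the
   two-sided bound on the weight A sandwiches A^(-1/(p-1)) between multiples of
   (t - t0)^(-r), which is integrable at t0 exactly when r < 1.  When r >= 1, i.e.
   beta >= p - 1, test the capacity with
     v(t) = (ln (t - t0 + h) - ln h) / L,  L = ln (d + h) - ln h;
   then |v'|^p A <= c (t - t0 + h)^(beta - p) / L^p is at most a constant times
   (t - t0 + h)^-1 / L^p, whose integral over (t0, t0 + d) is L^(1 - p), and this
   tends to 0 with h because p > 1. *)
Require Import Defs.
From HB Require Import structures.
From mathcomp Require Import all_boot all_order all_algebra.
From mathcomp Require Import all_classical all_reals all_analysis.
From mathcomp Require Import measurable_realfun.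
From mathcomp Require Import ring lra.

Set Implicit Arguments.
Unset Strict Implicit.
Unset Printing Implicit Defensive.

Import Order.TTheory GRing.Theory Num.Theory.
Import numFieldNormedType.Exports HBNNSimple.
Local Open Scope classical_set_scope.
Local Open Scope ring_scope.

(** * Comparison of integrals up to a null set *)

Lemma aeS {d} {T : measurableType d} {R : realType}
    (mu : {measure set T -> \bar R}) (P Q : T -> Prop) :
  (forall x, P x -> Q x) ->
  {ae mu, forall x, P x} -> {ae mu, forall x, Q x}.
Proof. by move=> PQ; apply: filterS. Qed.

(* [f] and [g] need not be measurable: the integral of a nonnegative function is
   defined as a supremum over simple functions below it.  This spares us the
   measurability of the energy weight, which would need the coarea formula. *)
Lemma ae_ge0_le_lower_integral {d} {T : measurableType d} {R : realType}
    (mu : {measure set T -> \bar R}) (D : set T) (f g : T -> \bar R) :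
  (forall x, D x -> (0 <= f x)%E) -> (forall x, D x -> (0 <= g x)%E) ->
  {ae mu, forall x, D x -> (f x <= g x)%E} ->
  (\int[mu]_(x in D) f x <= \int[mu]_(x in D) g x)%E.
Proof.
move=> f0 g0 [N [mN N0 fgN]].
rewrite [leLHS]ge0_integralE// [leRHS]ge0_integralE//.
apply: ge_ereal_sup => _ [h /= hf <-].
(* A simple function [h] below [f] is cut off on the exceptional null set [N]: its integral is
   unchanged, and the result [k] lies below [g] everywhere on [D]. *)
have mNc : measurable (~` N) by exact: measurableC.
pose k := proj_nnsfun h mNc.
rewrite -integralT_nnsfun (ge0_negligible_integral mN)//=; last 2 first.
- exact/measurable_EFinP.
- by move=> x _; rewrite lee_fin.
rewrite setTD integral_mkcond.
suff -> : ((fun x => (h x)%:E) \_ (~` N) = fun x => (k x)%:E)%E.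
  apply: ereal_sup_ubound; exists k; last exact/esym/integralT_nnsfun.
  move=> x /=; rewrite mindicE; case: (boolP (x \in ~` N)) => xN; last first.
    by rewrite mulr0; exact: erestrict_ge0.
  rewrite mulr1; apply: le_trans (hf x) _; rewrite !patchE.
  case: ifPn => //; rewrite inE => Dx.
  by move/subsetCl : fgN => /(_ x); rewrite inE in xN => /(_ xN); exact.
apply/funext => x /=; rewrite patchE mindicE.
by case: ifP => _; rewrite ?mulr1 ?mulr0.
Qed.

(** * The fundamental theorem of calculus on bounded intervals *)

Lemma continuous_within_itv {R : realType} (f : R -> R) (a b : R) :
  (forall x, a <= x <= b -> {for x, continuous f}) ->
  {within `[a, b], continuous f}.
Proof.
by move=> cf; apply: continuous_in_subspaceT => x; rewrite inE/= in_itv/=; exact: cf.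
Qed.

(** Continuity at the endpoints as well gives integrability on the compact interval, hence on its
    interior. *)
Lemma continuous_integrable_itvoo {R : realType} (f : R -> R) (a b : R) :
  (forall x, a <= x <= b -> {for x, continuous f}) ->
  (@lebesgue_measure R).-integrable `]a, b[ (EFin \o f).
Proof.
move=> cf; apply: (@integrableS _ _ _ (@lebesgue_measure R) `[a, b]%classic) => //.
  exact: subset_itv_oo_cc.
apply: continuous_compact_integrable; first exact: segment_compact.
exact: continuous_within_itv.
Qed.

Lemma is_derive1_continuous {R : realType} (f : R -> R) (x df : R) :
  is_derive x 1 f df -> {for x, continuous f}.
Proof.
by move=> [dfx _]; apply: differentiable_continuous; exact/derivable1_diffP.
Qed.

Section is_derive_itv.
Context {R : realType} (F f : R -> R) (a b : R).
Hypothesis ab : a < b.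
Hypothesis dF : forall x, a <= x <= b -> is_derive x 1 F (f x).

Lemma is_derive_oo_LRcontinuous : derivable_oo_LRcontinuous F a b.
Proof.
split.
- move=> x; rewrite in_itv/= => /andP[ax xb].
  by have [] : is_derive x 1 F (f x) by apply: dF; rewrite !ltW.
- apply: cvg_at_right_filter; apply: (is_derive1_continuous (df := f a)).
  by apply: dF; rewrite lexx ltW.
- apply: cvg_at_left_filter; apply: (is_derive1_continuous (df := f b)).
  by apply: dF; rewrite lexx ltW.
Qed.

Lemma is_derive_oo_derive1 : {in `]a, b[, F^`()%classic =1 f}.
Proof.
move=> x; rewrite in_itv/= => /andP[ax xb]; rewrite derive1E.
by have [_ ->] : is_derive x 1 F (f x) by apply: dF; rewrite !ltW.
Qed.

Hypothesis cf : forall x, a <= x <= b -> {for x, continuous f}.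

Lemma integral_itvcc_FTC :
  (\int[lebesgue_measure]_(x in `[a, b]) (f x)%:E = (F b - F a)%:E)%E.
Proof.
by rewrite (continuous_FTC2 ab (continuous_within_itv cf)
  is_derive_oo_LRcontinuous is_derive_oo_derive1).
Qed.

(** The endpoints form a null set. Energies and power integrals are taken over open intervals, so
    this is the form applied below. *)
Lemma integral_itvoo_FTC :
  (\int[lebesgue_measure]_(x in `]a, b[) (f x)%:E = (F b - F a)%:E)%E.
Proof.
rewrite -(@integral_itv_bndoo R a b _ true false) ?integral_itvcc_FTC//.
exact: (measurable_int _ (continuous_integrable_itvoo cf)).
Qed.

End is_derive_itv.

(** * Shifted logarithms and powers, and the convergent power integral *)

Lemma is_derive_subr {R : realType} (c x : R) : is_derive x 1 (fun t : R => t - c) 1.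
Proof.
rewrite -[X in is_derive _ _ _ X]subr0.
exact: (@is_deriveB _ _ _ id (cst c) x 1 1 0).
Qed.

Lemma is_derive_shift_ln {R : realType} (c x : R) : c < x ->
  is_derive x 1 (fun t : R => ln (t - c)) (x - c)^-1.
Proof.
move=> cx; rewrite -[X in is_derive _ _ _ X]mulr1.
apply: (is_derive1_comp (f := @ln R) (g := fun t => t - c)).
  by apply: is_derive1_ln; rewrite subr_gt0.
exact: is_derive_subr.
Qed.

Lemma is_derive_shift_powR {R : realType} (r c x : R) : c < x ->
  is_derive x 1 (fun t : R => (t - c) `^ r) (r * (x - c) `^ (r - 1)).
Proof.
move=> cx; rewrite -[X in is_derive _ _ _ X]mulr1.
apply: (is_derive1_comp (f := fun t => t `^ r) (g := fun t => t - c)).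
  by apply: is_derive1_powR; rewrite subr_gt0.
exact: is_derive_subr.
Qed.

Lemma continuous_shift_inv {R : realType} (c x : R) : c < x ->
  {for x, continuous (fun t : R => (t - c)^-1)}.
Proof.
move=> cx; apply: cvgV; first by rewrite subr_eq0 gt_eqF.
by apply: cvgB; [exact: cvg_id|exact: cvg_cst].
Qed.

Lemma integral_itvoo_shift_inv {R : realType} (c a b : R) : c < a -> a < b ->
  (\int[lebesgue_measure]_(x in `]a, b[) ((x - c)^-1)%:E =
   (ln (b - c) - ln (a - c))%:E)%E.
Proof.
move=> ca ab; apply: (integral_itvoo_FTC (F := fun t : R => ln (t - c))) => // x /andP[ax _].
  by apply: is_derive_shift_ln; exact: lt_le_trans ax.
by apply: continuous_shift_inv; exact: lt_le_trans ax.
Qed.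

Lemma continuous_shift_powR {R : realType} (r c x : R) : c < x ->
  {for x, continuous (fun t : R => (t - c) `^ r)}.
Proof.
by move=> cx; apply: is_derive1_continuous; exact: is_derive_shift_powR.
Qed.

Lemma measurable_shift_powR {R : realType} (r a : R) :
  measurable_fun [set: R] (fun x : R => ((x - a) `^ r)%:E).
Proof.
apply/measurable_EFinP; apply: (measurableT_comp (measurable_powR r)).
exact: measurable_funB.
Qed.

(** The integrand may blow up at [a], so the interval is exhausted by the sets [G k], which stay
    away from [a]. The integrals over them are bounded by [B] uniformly in [k], and monotone
    convergence carries the bound over. *)
Lemma integral_powR_shift_lty {R : realType} (r a b : R) : r < 1 ->
  (\int[lebesgue_measure]_(x in `]a, b[) ((x - a) `^ (- r))%:E < +oo)%E.
Proof.
move=> r1; rewrite itv_open_bnd_bigcup.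
have r1' : 1 - r > 0 by rewrite subr_gt0.
have powm := measurable_shift_powR (- r) a.
pose G (k : nat) := `[a + k.+1%:R^-1, b[%classic : set R.
pose B := (b - a) `^ (1 - r) / (1 - r).
have cvgG : (\int[lebesgue_measure]_(x in G k) ((x - a) `^ (- r))%:E @[k --> \oo] -->
    \int[lebesgue_measure]_(x in \bigcup_k G k) ((x - a) `^ (- r))%:E)%E.
  apply: ge0_nondecreasing_set_cvg_integral => //.
  - apply/nondecreasing_seqP => k; rewrite subsetEset; apply: subset_itvr.
    by rewrite bnd_simp lerD2l lef_pV2 ?posrE ?ltr0n// ler_nat.
  - by move=> k; exact: measurable_itv.
  - by move=> k; exact: measurable_funS powm.
  - by move=> k x _; rewrite lee_fin powR_ge0.
apply: (@le_lt_trans _ _ B%:E); last exact: ltry.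
apply: (cvge_to_le cvgG); apply: nearW => k.
have ak : a < a + k.+1%:R^-1 :> R by rewrite ltrDl invr_gt0 ltr0n.
(* For small [k] the set [G k] may be empty. *)
have [akb|bak] := ltP (a + k.+1%:R^-1 : R) b; last first.
  by rewrite /G set_itv_ge ?bnd_simp -?leNgt// integral_set0 lee_fin divr_ge0 ?powR_ge0 ?ltW.
rewrite (@integral_itv_bndoo R _ _ _ true true); last exact: measurable_funS powm.
pose F t := (1 - r)^-1 *: (t - a) `^ (1 - r).
have dF x : a + k.+1%:R^-1 <= x <= b -> is_derive x 1 F ((x - a) `^ (- r)).
  move=> /andP[akx _].
  have -> : (x - a) `^ (- r) = (1 - r)^-1 *: ((1 - r) * (x - a) `^ (1 - r - 1)).
    by rewrite scalerA mulVf ?gt_eqF// scale1r; congr (_ `^ _); ring.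
  by apply: is_deriveZ; apply: is_derive_shift_powR; exact: lt_le_trans akx.
rewrite (integral_itvoo_FTC akb dF); last first.
  by move=> x /andP[akx _]; apply: continuous_shift_powR; exact: lt_le_trans akx.
(* [B] is [F b]; the subtracted value of [F] at the left endpoint is nonnegative because [r < 1]. *)
by rewrite lee_fin /F /B mulrC gerBl mulr_ge0 ?powR_ge0 ?invr_ge0 ?ltW.
Qed.

(** * Regularity criteria for admissible functions of the capacity *)

Section sobolev_C1.
Context {R : realType} (v w : R -> R) (a b : R).
Hypothesis ab : a < b.
Hypothesis dv : forall x, a <= x <= b -> is_derive x 1 v (w x).
Hypothesis cw : forall x, a <= x <= b -> {for x, continuous w}.
Local Notation mu := (@lebesgue_measure R).

Lemma Rintegral_itvoo_itvcc (f : R -> R) :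
  (forall x, a <= x <= b -> {for x, continuous f}) ->
  \int[mu]_(x in `]a, b[) f x = \int[mu]_(x in `[a, b]) f x.
Proof.
move=> /continuous_integrable_itvoo/measurable_int mf.
by rewrite /Rintegral (@integral_itv_bndoo R a b _ true false).
Qed.

(** The classical derivative serves as weak derivative, by integration by parts. *)
Lemma C1_sobolev11 : sobolev11 a b v.
Proof.
have cv x : a <= x <= b -> {for x, continuous v}.
  by move=> /dv/is_derive1_continuous.
split; first exact: continuous_integrable_itvoo.
exists w; first exact: continuous_integrable_itvoo.
move=> phi [dphi _ phi_supp].
(* The support of [phi] lies in the open interval, so [phi] vanishes at both endpoints and the
   boundary terms disappear. *)
have phi0 x : x \notin `]a, b[ -> phi x = 0.
  move=> xab; apply/eqP/negP => /negP phix; move/negP: xab; apply.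
  by apply: phi_supp; apply: subset_closure.
have dphi1 (x : R) : is_derive x 1 phi (phi^`()%classic x).
  by split; [exact: (dphi 0)|rewrite derive1E].
have cphi (x : R) : {for x, continuous phi} := is_derive1_continuous (dphi1 x).
have cdphi (x : R) : {for x, continuous phi^`()%classic}.
  have := dphi 1 x; rewrite derive1n1 => /derivable1_diffP.
  exact: differentiable_continuous.
rewrite Rintegral_itvoo_itvcc; last first.
  by move=> x /cv cvx; apply: continuousM.
rewrite Rintegral_itvoo_itvcc; last first.
  by move=> x /cw cwx; apply: continuousM.
rewrite (@Rintegration_by_parts R v phi w phi^`()%classic a b ab).
- by rewrite [phi b]phi0 ?[phi a]phi0 ?in_itv/= ?ltxx ?andbF// !mulr0 subrr sub0r.
- exact: continuous_within_itv.
- exact: is_derive_oo_LRcontinuous.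
- exact: is_derive_oo_derive1.
- exact: continuous_within_itv.
- exact: (is_derive_oo_LRcontinuous (f := phi^`()%classic)).
- by [].
Qed.

End sobolev_C1.

Lemma lipschitz_abs_continuous {R : realType} (v : R -> R) (a b K : R) :
  (forall x y, a <= x -> x <= y -> y <= b -> `|v y - v x| <= K * (y - x)) ->
  abs_continuous a b v.
Proof.
(* [K] has no prescribed sign; [|K| + 1] is a positive Lipschitz constant by which one can
   divide. *)
move=> vK e e0; have K1 : 0 < `|K| + 1 by rewrite ltr_wpDl.
exists (e / (`|K| + 1)); first exact: divr_gt0.
move=> m x y xy _ sum_lt.
apply: (@le_lt_trans _ _ ((`|K| + 1) * \sum_(i < m) (y i - x i))); last first.
  by rewrite mulrC -ltr_pdivlMr.
rewrite mulr_sumr; apply: ler_sum => i _; have [axi [xyi yib]] := xy i.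
apply: le_trans (vK _ _ axi xyi yib) _.
by rewrite ler_wpM2r ?subr_ge0// (le_trans (ler_norm K))// lerDl ler01.
Qed.

(** * Estimates at the singular endpoint *)

Lemma ln_gap_large {R : realType} (d M : R) : 0 < d ->
  exists2 h : R, 0 < h <= 1 & M < ln (d + h) - ln h.
Proof.
(* This choice gives [h * expR M <= d < d + h]. The cap at 1 serves the energy estimate, where
   [d + h] is bounded by [d + 1]. *)
move=> d0; pose h := Num.min 1 (d * expR (- M)).
have h0 : 0 < h by rewrite lt_min ltr01 mulr_gt0// expR_gt0.
exists h; first by rewrite h0 ge_min lexx.
rewrite ltrBrDr -(expRK M) -lnM ?posrE ?expR_gt0// ltr_ln ?posrE ?mulr_gt0 ?expR_gt0 ?addr_gt0//.
apply: (@le_lt_trans _ _ d); last by rewrite ltrDl.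
rewrite mulrC -ler_pdivlMr ?expR_gt0// -expRN.
by rewrite ge_min lexx orbT.
Qed.

(** The bounds force [A] to be finite and positive. Raising to the power [q > 0] keeps the order and
    inversion reverses it, so [c2] moves to the lower bound and [c1] to the upper one. *)
Lemma inve_poweR_bounds {R : realType} (c1 c2 s beta q : R) (A : \bar R) :
  0 < c1 -> 0 < c2 -> 0 < s -> 0 < q ->
  ((c1 * s `^ beta)%:E <= A <= (c2 * s `^ beta)%:E)%E ->
  ((c2 `^ (- q) * s `^ (- (beta * q)))%:E <= (A `^ q)^-1
    <= (c1 `^ (- q) * s `^ (- (beta * q)))%:E)%E.
Proof.
move=> c10 c20 s0 q0; case: A => [a| |]; rewrite ?lee_fin; last 2 first.
- by rewrite leye_eq andbF.
- by rewrite leeNy_eq.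
have sb0 : 0 < s `^ beta by exact: powR_gt0.
move=> /andP[ca ac]; have a0 : 0 < a by apply: lt_le_trans ca; exact: mulr_gt0.
have aq0 : 0 < a `^ q by exact: powR_gt0.
have powE c : 0 < c -> c `^ (- q) * s `^ (- (beta * q)) = ((c * s `^ beta) `^ q)^-1.
  move=> c0; rewrite powRM ?ltW// invfM -powRrM -!powRN.
  by rewrite -mulrN.
rewrite poweR_EFin inver gt_eqF// !lee_fin !powE//.
rewrite !lef_pV2 ?posrE ?powR_gt0 ?mulr_gt0//.
by rewrite !ge0_ler_powR ?nnegrE ?(ltW a0) ?(ltW q0) ?mulr_ge0 ?(ltW c10) ?(ltW c20) ?(ltW sb0).
Qed.

Lemma energy_weight_ge0 {R : realType} n (Omega : set 'rV[R]_n) p theta t :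
  (0 <= energy_weight Omega p theta t)%E.
Proof. by apply: integral_ge0 => x _; rewrite lee_fin powR_ge0. Qed.

(** On the interval the integrand dominates [C * (x - a + h)^-1] for every [h > 0]. The shift
    removes the singularity, so the minorant integrates exactly to [C] times a logarithmic gap,
    which exceeds any [M / C] for suitable [h]. *)
Lemma integral_powR_shift_y {R : realType} (r a b : R) : 1 <= r -> a < b ->
  (\int[lebesgue_measure]_(x in `]a, b[) ((x - a) `^ (- r))%:E = +oo)%E.
Proof.
move=> r1 ab; apply/eqyP => M M0.
have ba0 : 0 < b - a by rewrite subr_gt0.
pose C := (b - a) `^ (1 - r).
have C0 : 0 < C by exact: powR_gt0.
have [h /andP[h0 _] Mh] := ln_gap_large (M / C) ba0.
have aha : a - h < a by rewrite ltrBlDr ltrDl.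
apply: (@le_trans _ _ (C%:E * (\int[lebesgue_measure]_(x in `]a, b[) ((x - (a - h))^-1)%:E))%E).
  rewrite integral_itvoo_shift_inv// -EFinM lee_fin -ler_pdivrMl// mulrC.
  by have -> : b - (a - h) = b - a + h by [ring]; have -> : a - (a - h) = h by [ring]; exact: ltW.
rewrite -ge0_integralZl_EFin ?(ltW C0)//; last 2 first.
- by move=> x /=; rewrite in_itv/= => /andP[ax _]; rewrite lee_fin invr_ge0 subr_ge0 ltW// (lt_trans aha).
- apply: (measurable_int lebesgue_measure); apply: continuous_integrable_itvoo.
  by move=> x /andP[ax _]; apply: continuous_shift_inv; exact: lt_le_trans ax.
apply: ae_ge0_le_lower_integral.
- move=> x; rewrite /= in_itv/= => /andP[ax _].
  by rewrite -EFinM lee_fin mulr_ge0 ?invr_ge0 ?subr_ge0 ?ltW// (lt_trans aha).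
- by move=> x _; rewrite lee_fin powR_ge0.
apply: aeW => x /=; rewrite in_itv/= => /andP[ax xb].
have xa0 : 0 < x - a by rewrite subr_gt0.
rewrite -EFinM lee_fin.
have -> : (x - a) `^ (- r) = (x - a) `^ (1 - r) * (x - a)^-1.
  rewrite -powR_inv1 ?ltW// -powRD; first by congr (_ `^ _); ring.
  by rewrite (gt_eqF xa0) implybT.
apply: ler_pM => //; first exact: ltW.
- by rewrite invr_ge0 subr_ge0 ltW// (lt_trans aha).
- have opp : 1 - r = - (r - 1) by ring.
  rewrite /C opp !powRN lef_pV2 ?posrE ?powR_gt0//.
  by rewrite ge0_ler_powR ?nnegrE ?(ltW xa0) ?(ltW ba0) ?subr_ge0 ?lerD2r ?(ltW xb).
- by rewrite lef_pV2 ?posrE ?subr_gt0 ?(lt_trans aha)// lerD2l lerN2 ltW.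
Qed.

Lemma capacity_ge0 {R : realType} n (Omega : set 'rV[R]_n) p theta a b :
  (0 <= capacity Omega p theta a b)%E.
Proof.
apply: le_ereal_inf_tmp => _ [v _ <-]; apply: integral_ge0 => t _.
by rewrite mule_ge0 ?lee_fin ?powR_ge0// energy_weight_ge0.
Qed.

(** * The logarithmic cutoff and its energy *)

Section log_profile.
Context {R : realType} (t0 d h : R).
Hypotheses (d0 : 0 < d) (h0 : 0 < h).
Local Notation L := (ln (d + h) - ln h).

(* The logarithmic cutoff, shifted by [h] so that it is C^1 up to the endpoint
   [t0]; [L] tends to [+oo] as [h] tends to [0]. *)
Definition log_profile (t : R) : R := L^-1 *: (ln (t - (t0 - h)) - ln h).

Definition log_profile' (t : R) : R := L^-1 *: (t - (t0 - h))^-1.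

Let shift_gt0 t : t0 <= t -> 0 < t - (t0 - h).
Proof. by move=> t0t; rewrite subr_gt0; apply: lt_le_trans t0t; rewrite ltrBlDr ltrDl. Qed.

Let L_gt0 : 0 < L.
Proof. by rewrite subr_gt0 ltr_ln ?posrE ?addr_gt0// ltrDr. Qed.

Lemma is_derive_log_profile t : t0 <= t -> is_derive t 1 log_profile (log_profile' t).
Proof.
move=> t0t; apply: is_deriveZ.
rewrite -[X in is_derive _ _ _ X]subr0.
apply: (@is_deriveB _ _ _ (fun t : R => ln (t - (t0 - h))) (cst (ln h)) t 1 _ 0).
by apply: is_derive_shift_ln; rewrite -subr_gt0 shift_gt0.
Qed.

Lemma continuous_log_profile' t : t0 <= t -> {for t, continuous log_profile'}.
Proof.
move=> t0t; apply: cvgZr; apply: continuous_shift_inv.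
by rewrite -subr_gt0 shift_gt0.
Qed.

(** The difference of logarithms is [ln (1 + u)], where [u] is [y - x] divided by the shifted
    variable at [x]. Then [ln (1 + u) <= u], and the shifted variable is at least [h]. *)
Lemma log_profile_lipschitz x y : t0 <= x -> x <= y ->
  `|log_profile y - log_profile x| <= (L * h)^-1 * (y - x).
Proof.
move=> tx xy; have x0 := shift_gt0 tx; have y0 := shift_gt0 (le_trans tx xy).
have -> : log_profile y - log_profile x =
    L^-1 * (ln (y - (t0 - h)) - ln (x - (t0 - h))).
  by rewrite /log_profile /GRing.scale/=; ring.
have xyh : x - (t0 - h) <= y - (t0 - h) by rewrite lerD2r.
rewrite ger0_norm; last first.
  by rewrite mulr_ge0 ?invr_ge0 ?(ltW L_gt0)// subr_ge0 ler_ln ?posrE.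
rewrite invfM -mulrA ler_wpM2l ?invr_ge0 ?(ltW L_gt0)// -ln_div ?posrE//.
have -> : (y - (t0 - h)) / (x - (t0 - h)) = 1 + (y - x) / (x - (t0 - h)).
  by field; rewrite gt_eqF.
have yx0 : 0 <= (y - x) / (x - (t0 - h)) by rewrite divr_ge0 ?(ltW x0) ?subr_ge0.
apply: (le_trans (le_ln1Dx _)); first by apply: lt_le_trans yx0; rewrite ltrN10.
rewrite mulrC ler_wpM2r ?subr_ge0// lef_pV2 ?posrE//.
by move: tx; lra.
Qed.

Lemma log_profile_l : log_profile t0 = 0.
Proof.
by rewrite /log_profile subKr subrr scaler0.
Qed.

Lemma log_profile_r : log_profile (t0 + d) = 1.
Proof.
rewrite /log_profile; have -> : t0 + d - (t0 - h) = d + h by ring.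
by rewrite /GRing.scale/= mulVf// gt_eqF.
Qed.

(** With [s = t - t0 + h], the energy density is at most [C * s^-1] almost everywhere. The integral
    of [s^-1] is [L], which turns the [L]^ (- p)[inside]C[into]L [^ (1 - p)]. *)
Lemma energy_log_profile_le n (Omega : set 'rV[R]_n) p theta c beta :
  1 < p -> p - 1 <= beta -> 0 < c -> h <= 1 ->
  {ae (@lebesgue_measure R), forall t : R, t0 < t < t0 + d ->
    (energy_weight Omega p theta t <= (c * (t - t0) `^ beta)%:E)%E} ->
  (energy Omega p theta log_profile t0 (t0 + d) <=
   (c * (d + 1) `^ (beta - p + 1) / L `^ (p - 1))%:E)%E.
Proof.
move=> p1 pbeta c0 h1 weight_le.
have td : t0 < t0 + d by rewrite ltrDl.
have hbeta : 0 <= beta - p + 1 by lra.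
pose C := c * (d + 1) `^ (beta - p + 1) * L `^ (- p).
have C0 : 0 <= C by rewrite !mulr_ge0 ?powR_ge0// ltW.
have hlt : t0 - h < t0 by rewrite ltrBlDr ltrDl.
apply: (@le_trans _ _ (C%:E * (\int[lebesgue_measure]_(t in `]t0, (t0 + d)%R[)
    ((t - (t0 - h))^-1)%:E))%E); last first.
  rewrite integral_itvoo_shift_inv//.
  have -> : t0 + d - (t0 - h) = d + h by ring.
  have -> : t0 - (t0 - h) = h by ring.
  rewrite -EFinM lee_fin /C -!mulrA ler_wpM2l ?(ltW c0)// ler_wpM2l ?powR_ge0//.
  rewrite -[X in _ * X](powRr1 (ltW L_gt0)) -powRD ?(gt_eqF L_gt0) ?implybT//.
  by rewrite -powRN opprB [- p + 1]addrC.
rewrite -ge0_integralZl_EFin//; last 2 first.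
- by move=> x /=; rewrite in_itv/= => /andP[/ltW/shift_gt0 x0 _]; rewrite lee_fin invr_ge0 ltW.
- apply: (measurable_int lebesgue_measure); apply: continuous_integrable_itvoo.
  by move=> x /andP[ax _]; apply: continuous_shift_inv; exact: lt_le_trans ax.
apply: ae_ge0_le_lower_integral.
- by move=> t _; rewrite mule_ge0 ?lee_fin ?powR_ge0// energy_weight_ge0.
- move=> x /=; rewrite in_itv/= => /andP[/ltW/shift_gt0 x0 _].
  by rewrite -EFinM lee_fin mulr_ge0// invr_ge0 ltW.
apply: (aeS _ weight_le) => t wt /=; rewrite in_itv/= => tt.
have {wt} := wt tt; move: tt => /andP[t0t ttd].
have s0 := shift_gt0 (ltW t0t); set s := t - (t0 - h) in s0 *.
have -> : log_profile^`()%classic t = (L * s)^-1.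
  rewrite derive1E; have [_ ->] := is_derive_log_profile (ltW t0t).
  by rewrite invfM.
(* Since [beta >= p - 1 > 0], the weight bound only grows when [t - t0] is replaced by the larger
   [s], so that a single variable remains. *)
move=> wt; apply: (@le_trans _ _ (((L * s) `^ (- p))%:E * (c * s `^ beta)%:E)%E).
  apply: lee_pmul; rewrite ?lee_fin ?powR_ge0// ?energy_weight_ge0//.
    rewrite ger0_norm ?invr_ge0 ?mulr_ge0 ?(ltW L_gt0) ?(ltW s0)//.
    by rewrite -powR_inv1 ?mulr_ge0 ?(ltW L_gt0) ?(ltW s0)// -powRrM mulN1r.
  apply: (le_trans wt); rewrite lee_fin ler_wpM2l ?(ltW c0)//.
  rewrite ge0_ler_powR ?nnegrE ?(ltW s0) ?subr_ge0 ?(ltW t0t)//; first by lra.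
  by rewrite /s; lra.
rewrite -!EFinM lee_fin powRM ?(ltW L_gt0) ?(ltW s0)//.
(* One factor [s^-1] is split off; the remaining exponent [beta - p + 1] is nonnegative, so that
   power is at most its value at [d + 1 >= s]. *)
have -> : L `^ (- p) * s `^ (- p) * (c * s `^ beta) =
    c * s `^ (beta - p + 1) * L `^ (- p) * s^-1.
  have sE : s `^ (- p) * s `^ beta = s `^ (beta - p + 1) * s^-1.
    by rewrite -(powR_inv1 (ltW s0)) -!powRD ?(gt_eqF s0) ?implybT//; congr (_ `^ _); ring.
  by rewrite -mulrA (mulrCA _ c) sE; ring.
rewrite /C ler_wpM2r ?invr_ge0 ?(ltW s0)// ler_wpM2r ?powR_ge0// ler_wpM2l ?(ltW c0)//.
rewrite ge0_ler_powR ?nnegrE ?(ltW s0)//; first by lra.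
by rewrite /s; lra.
Qed.

End log_profile.

Lemma capacity_eq0 {R : realType} n (Omega : set 'rV[R]_n) p theta
    (t0 d c beta : R) : 0 < d -> 1 < p -> p - 1 <= beta -> 0 < c ->
  {ae (@lebesgue_measure R), forall t : R, t0 < t < t0 + d ->
    (energy_weight Omega p theta t <= (c * (t - t0) `^ beta)%:E)%E} ->
  capacity Omega p theta t0 (t0 + d) = 0%E.
Proof.
move=> d0 p1 pbeta c0 weight_le.
apply/eqP; rewrite eq_le capacity_ge0 andbT.
apply/lee_addgt0Pr => e e0; rewrite add0e.
pose K := c * (d + 1) `^ (beta - p + 1).
have K0 : 0 < K by rewrite mulr_gt0// powR_gt0// addr_gt0.
have [h /andP[h0 h1] hL] := ln_gap_large ((K / e) `^ (p - 1)^-1) d0.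
have Le : (energy Omega p theta (log_profile t0 d h) t0 (t0 + d) <= e%:E)%E.
  apply: le_trans (energy_log_profile_le d0 h0 p1 pbeta c0 h1 weight_le) _.
  have L0 := le_lt_trans (powR_ge0 _ _) hL.
  rewrite lee_fin -/K ler_pdivrMr ?powR_gt0// mulrC -ler_pdivrMr//.
  have -> : K / e = ((K / e) `^ (p - 1)^-1) `^ (p - 1).
    by rewrite -powRrM mulVf ?powRr1 ?divr_ge0 ?(ltW K0) ?(ltW e0)// subr_eq0 gt_eqF.
  by rewrite ge0_ler_powR ?nnegrE ?powR_ge0 ?(ltW L0) ?(ltW hL) ?subr_ge0 ?(ltW p1).
apply: (le_trans _ Le); apply: ereal_inf_lbound; exists (log_profile t0 d h) => //.
split.
- apply: (C1_sobolev11 (w := log_profile' t0 d h)); first by rewrite ltrDl.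
  + by move=> x /andP[xt _]; exact: is_derive_log_profile.
  + by move=> x /andP[xt _]; exact: continuous_log_profile'.
- apply: lipschitz_abs_continuous => x y tx xy _.
  exact: log_profile_lipschitz.
- exact: log_profile_l.
- exact: log_profile_r.
- exact: le_lt_trans Le (ltry _).
Qed.

(** * The integrability criterion and the vanishing of the capacity *)

Theorem theorem1p3 (R : realType) (n : nat) (n_gt0 : (0 < n)%N)
    (Omega : set 'rV[R]_n) (p : R) (theta : 'rV[R]_n -> R)
    (t0 d0 c1 c2 alpha nu : R)
    (Omega_open : open Omega) (Omega_bounded : bounded_set Omega)
    (p_gt1 : 1 < p)
    (theta_lipschitz : [lipschitz theta x | x in closure Omega])
    (d0_gt0 : 0 < d0) (c1_gt0 : 0 < c1) (c2_gt0 : 0 < c2)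
    (alpha_range : 0 <= alpha < 1) (nu_ge0 : 0 <= nu)
    (weight_bounds :
      {ae (@lebesgue_measure R), forall t : R, t0 < t < t0 + d0 ->
        ((c1 * (t - t0) `^ (alpha * (p - 1) + nu))%:E
           <= energy_weight Omega p theta t
           <= (c2 * (t - t0) `^ (alpha * (p - 1) + nu))%:E)%E}) :
  (forall d : R, 0 < d < d0 ->
    ((\int[@lebesgue_measure R]_(t in `]t0, (t0 + d)%R[%classic)
        (energy_weight Omega p theta t `^ (p - 1)^-1%R)^-1 < +oo)%E
     <-> alpha + nu / (p - 1) < 1))
  /\
  (1 <= alpha + nu / (p - 1) ->
   forall d : R, 0 < d < d0 -> capacity Omega p theta t0 (t0 + d) = 0%E).
Proof.
have p10 : 0 < p - 1 by rewrite subr_gt0.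
have q0 : 0 < (p - 1)^-1 by rewrite invr_gt0.
set beta := alpha * (p - 1) + nu in weight_bounds.
have rE : beta * (p - 1)^-1 = alpha + nu / (p - 1).
  by rewrite /beta mulrDl mulfK// gt_eqF.
split; last first.
  move=> r1 d /andP[dgt0 dd0].
  apply: (@capacity_eq0 _ _ _ _ _ _ _ c2 beta) => //.
    (* Through [rE], the condition [1 <= alpha + nu / (p - 1)] is the same as [p - 1 <= beta]. *)
    by rewrite -[leLHS]mul1r -ler_pdivlMr// rE.
  apply: (aeS _ weight_bounds) => t wt /andP[t0t ttd].
  have /wt/andP[//] : t0 < t < t0 + d0.
  by rewrite t0t (lt_trans ttd)// ltrD2l.
move=> d /andP[dgt0 dd0].
pose r := alpha + nu / (p - 1).
have td : t0 < t0 + d by rewrite ltrDl.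
pose W t := ((energy_weight Omega p theta t `^ (p - 1)^-1)^-1)%E.
have W_ge0 t : (0 <= W t)%E by rewrite inve_ge0 poweR_ge0.
(* Inverting the weight exchanges the roles of [c1] and [c2], and the exponent [beta] becomes
   [- r]. *)
have W_bounds : {ae (@lebesgue_measure R), forall t : R, `]t0, (t0 + d)%R[%classic t ->
    ((c2 `^ (- (p - 1)^-1))%:E * ((t - t0) `^ (- r))%:E <= W t
      <= (c1 `^ (- (p - 1)^-1))%:E * ((t - t0) `^ (- r))%:E)%E}.
  apply: (aeS _ weight_bounds) => t wt; rewrite /= in_itv/= => /andP[t0t ttd].
  have /wt : t0 < t < t0 + d0 by rewrite t0t (lt_trans ttd)// ltrD2l.
  rewrite /r -rE -!EFinM; apply: inve_poweR_bounds => //.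
  by rewrite subr_gt0.
have pow_ge0 (c t : R) : (0 <= (c `^ (- (p - 1)^-1))%:E * ((t - t0) `^ (- r))%:E)%E.
  by rewrite -EFinM lee_fin mulr_ge0 ?powR_ge0.
have pow_int (c : R) : 0 < c -> (\int[@lebesgue_measure R]_(t in `]t0, (t0 + d)%R[%classic)
    ((c `^ (- (p - 1)^-1))%:E * ((t - t0) `^ (- r))%:E) =
   (c `^ (- (p - 1)^-1))%:E * \int[@lebesgue_measure R]_(t in `]t0, (t0 + d)%R[%classic)
    ((t - t0) `^ (- r))%:E)%E.
  move=> c0; rewrite ge0_integralZl_EFin ?powR_ge0//.
  - by move=> t _; rewrite lee_fin powR_ge0.
  - by apply: (measurable_funS measurableT) => //; exact: measurable_shift_powR.
(* For [r < 1] the upper bound on [W] has a finite integral. *)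
split => [W_lty|r1]; last first.
  apply: (@le_lt_trans _ _ ((c1 `^ (- (p - 1)^-1))%:E *
    \int[@lebesgue_measure R]_(t in `]t0, (t0 + d)%R[%classic) ((t - t0) `^ (- r))%:E)%E).
    rewrite -pow_int//; apply: ae_ge0_le_lower_integral => [t _|t _|].
    - exact: W_ge0.
    - exact: pow_ge0.
    by apply: (aeS _ W_bounds) => t /= wt /wt/andP[].
  apply: lte_mul_pinfty; rewrite ?lee_fin ?powR_ge0//.
  exact: integral_powR_shift_lty.
(* If [r >= 1], the lower bound on [W] already has infinite integral, against the assumed
   finiteness. *)
rewrite ltNge; apply/negP => r1; move: W_lty; apply/negP; rewrite -leNgt.
apply: (@le_trans _ _ (\int[@lebesgue_measure R]_(t in `]t0, (t0 + d)%R[%classic)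
    ((c2 `^ (- (p - 1)^-1))%:E * ((t - t0) `^ (- r))%:E))%E).
  by rewrite pow_int// integral_powR_shift_y// gt0_muley// lte_fin powR_gt0.
apply: ae_ge0_le_lower_integral => [t _|t _|].
- exact: pow_ge0.
- exact: W_ge0.
by apply: (aeS _ W_bounds) => t /= wt /wt/andP[].
Qed.
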